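(* For every $1\le q<2$, $\lim_{d\to\infty}\mathfrak{p}_d(q)\le0$.
   Context: $\mathbb{T}^d$ is the $d$-fold torus with normalized Haar measure. $H^p(\mathbb{T}^d)$ denotes the Hardy space (for $p\ge1$: functions in $L^p(\mathbb{T}^d)$ with Fourier coefficients supported in $\mathbb{N}_0^d$; for $0<p<1$ the usual Hardy space on the polydisc). The Riesz projection is $P_+\psi=\sum_{\alpha\in\mathbb{N}_0^d}\widehat\psi(\alpha)z^\alpha$. For nontrivial $\varphi$ in some $H^p(\mathbb{T}^d)$, $\|\varphi\|_0:=\exp\left(\int_{\mathbb{T}^d}\log|\varphi|\right)$. For $1\le q\le\infty$, $\mathfrak{p}_d(q):=\sup\{p\ge0: \|P_+\psi\|_p\le\|\psi\|_q \text{ for every }\psi\in L^q(\mathbb{T}^d)\}$ if this set is nonempty, and $\mathfrak{p}_d(q):=-1$ otherwise. (For fixed $q$, $d\mapsto\mathfrak{p}_d(q)$ is nonincreasing, so the limit exists in $[-1,\infty)$.) *)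

(* Defs.v *)
From HB Require Import structures.
From mathcomp Require Import all_boot all_order all_algebra.
From mathcomp Require Import all_classical all_reals all_analysis.
From mathcomp.real_closed Require Import complex.

Set Implicit Arguments.
Unset Strict Implicit.
Unset Printing Implicit Defensive.

Import Order.TTheory GRing.Theory Num.Theory.
Import numFieldNormedType.Exports.

Local Open Scope classical_set_scope.
Local Open Scope ring_scope.

Section Torus.
Context {R : realType}.

(* A point of T^d is encoded by its angular coordinates x = (x_1,...,x_d)
   in [0,1]^d, i.e. zeta_j = exp(2 pi i x_j).  Functions on T^d are
   functions on d.-tuple R, only their values on [0,1]^d matter. *)

(* Normalized Haar integral on T^d of a nonnegative (extended real) function,
   computed as the iterated Lebesgue integral over [0,1]^d (Tonelli). *)
Fixpoint haar_int (d : nat) : (d.-tuple R -> \bar R) -> \bar R :=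
  match d return (d.-tuple R -> \bar R) -> \bar R with
  | 0 => fun f => f [tuple]
  | n.+1 => fun f =>
      (\int[lebesgue_measure]_(t in `[0%R, 1%R])
          haar_int (fun x : n.-tuple R => f (cons_tuple t x)))%E
  end.

Definition haar_intR (d : nat) (f : d.-tuple R -> R) : R :=
  fine (haar_int (fun x => (Num.max (f x) 0)%:E))
  - fine (haar_int (fun x => (Num.max (- f x) 0)%:E)).

Definition expi (t : R) : R[i] := (cos (2 * pi * t) +i* sin (2 * pi * t))%C.

Definition cabs (z : R[i]) : R := Num.sqrt (complex.Re z ^+ 2 + complex.Im z ^+ 2).

Definition cube (d : nat) : set (d.-tuple R) :=
  [set x | forall j : 'I_d, 0 <= tnth x j <= 1].


Definition inLq (d : nat) (q : R) (psi : d.-tuple R -> R[i]) : Prop :=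
  [/\ measurable_fun (@cube d) (fun x => complex.Re (psi x)),
      measurable_fun (@cube d) (fun x => complex.Im (psi x)) &
      (haar_int (fun x => (cabs (psi x) `^ q)%:E) < +oo)%E].

Definition Lqnorm (d : nat) (q : R) (psi : d.-tuple R -> R[i]) : R :=
  fine (haar_int (fun x => (cabs (psi x) `^ q)%:E)) `^ q^-1.

Definition fourier (d : nat) (psi : d.-tuple R -> R[i]) (alpha : 'I_d -> nat)
    : R[i] :=
  let ch x := expi (- \sum_(j < d) (alpha j)%:R * tnth x j) in
  (haar_intR (fun x => complex.Re (psi x * ch x))
   +i* haar_intR (fun x => complex.Im (psi x * ch x)))%C.

Definition riesz_partial (d : nat) (psi : d.-tuple R -> R[i]) (N : nat)
    (z : 'I_d -> R[i]) : R[i] :=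
  \sum_(a : {ffun 'I_d -> 'I_N})
     fourier psi (fun j => nat_of_ord (a j)) * \prod_(j < d) z j ^+ a j.

(* P_+ psi, as the holomorphic function
   z |-> sum_{alpha in N_0^d} hat(psi)(alpha) z^alpha  on the open polydisc *)
Definition riesz (d : nat) (psi : d.-tuple R -> R[i]) (z : 'I_d -> R[i])
    : R[i] :=
  (limn (fun N => complex.Re (riesz_partial psi N z))
   +i* limn (fun N => complex.Im (riesz_partial psi N z)))%C.

Definition radial (d : nat) (r : R) (x : d.-tuple R) : 'I_d -> R[i] :=
  fun j => (r%:C)%C * expi (tnth x j).

(* Hardy space (quasi-)norm, p > 0:  sup_{0<=r<1} M_p(P_+ psi, r)
   (= +oo when P_+ psi is not in H^p(T^d)) *)
Definition Hp_norm (d : nat) (p : R) (psi : d.-tuple R -> R[i]) : \bar R :=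
  ereal_sup [set poweR (haar_int
                  (fun x => (cabs (riesz psi (radial r x)) `^ p)%:E)) p^-1
            | r in `[0%R, 1%R[ ].

Definition riesz_bdry (d : nat) (psi : d.-tuple R -> R[i]) (x : d.-tuple R)
    : R[i] :=
  (lim ((fun r => complex.Re (riesz psi (radial r x))) @ (1%R)^'-)
   +i* lim ((fun r => complex.Im (riesz psi (radial r x))) @ (1%R)^'-))%C.

Definition elog (y : R) : \bar R := if y == 0 then -oo%E else (ln y)%:E.

(* ||phi||_0 = exp (\int log |phi|)  (for phi = P_+ psi; equal to 0 if phi = 0) *)
Definition H0_norm (d : nat) (psi : d.-tuple R -> R[i]) : \bar R :=
  expeR (haar_int (fun x => maxe (elog (cabs (riesz_bdry psi x))) 0%E)
         - haar_int (fun x => maxe (- elog (cabs (riesz_bdry psi x))) 0%E))%E.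

Definition riesz_contractive (d : nat) (q p : R) : Prop :=
  forall psi : d.-tuple R -> R[i], inLq q psi ->
    if p == 0 then
      (exists s : R, 0 < s /\ (Hp_norm s psi < +oo)%E) /\
      (H0_norm psi <= (Lqnorm q psi)%:E)%E
    else (Hp_norm p psi <= (Lqnorm q psi)%:E)%E.

Definition contr_set (d : nat) (q : R) : set R :=
  [set p | 0 <= p /\ riesz_contractive d q p].

Definition pfrak (d : nat) (q : R) : \bar R :=
  if `[< contr_set d q !=set0 >] then ereal_sup (EFin @` contr_set d q)
  else (- 1)%E.

End Torus.

(* Main.v *)
Require Import Defs.
From HB Require Import structures.
From mathcomp Require Import all_boot all_order all_algebra.
From mathcomp Require Import all_classical all_reals all_analysis.
From mathcomp Require Import measurable_realfun.
From mathcomp.real_closed Require Import complex.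
From mathcomp Require Import ring lra.

(* Contractivity is tested on idempotent trigonometric polynomials.  Let
   phi(y, x) be the sum of the 2^k characters with exponents
   h_a = (ham(a, b)_b, a), for a, b in {0,1}^k, where ham is the Hamming
   distance.  Up to a unimodular factor, phi is the product over j of
   1 + e(x_j + c_j(y)), so ||phi||_q = ||1 + z||_q ^ k <= (eta sqrt 2)^k for some
   eta < 1, because q < 2.  The h_a are in convex position: if s is the indicator
   of the complement of B in the coordinates b, then h_a - s >= 0 if and only if
   a is in B.  Hence phi multiplied by the character of exponent -s has the same
   L^q norm, while its Riesz projection has modulus |sum_{a in B} z^(h_a)| on
   the torus.

   With Rudin-Shapiro signs, two signed sums P, Q of the z^(h_a) satisfy
   |P|^2 + |Q|^2 = 2^(k+1) pointwise.  Splitting P and Q according to the sign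
   gives four sets B; at every point one of the four projections has modulus at
   least 2^(k/2) / 2.  For every p > 0 some projection therefore has H^p norm at
   least 4^(-1/p) 2^(k/2) / 2, which exceeds (eta sqrt 2)^k for k large, uniformly
   in p >= p0.  The dimension 2^k + k is unbounded, so the limit is at most p0. *)

Set Implicit Arguments.
Unset Strict Implicit.
Unset Printing Implicit Defensive.

Import Order.TTheory GRing.Theory Num.Theory.
Import numFieldNormedType.Exports.
Local Open Scope classical_set_scope.
Local Open Scope ring_scope.

(** * Iterated Haar integral *)

Section HaarIntegral.
Context {R : realType}.

Lemma haar_int_ge0 (d : nat) (f : d.-tuple R -> \bar R) :
  (forall x, 0 <= f x)%E -> (0 <= haar_int f)%E.
Proof.
by elim: d f => [|d IH] f f0 //=; apply: integral_ge0 => t _; apply: IH.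
Qed.

(** The parameter space [T] is arbitrary so that the induction can absorb each peeled coordinate
    into it. The step is Tonelli's theorem, with [0,1] turned into an indicator factor on the whole
    line. *)
Lemma measurable_haar_int (d : nat) (dT : measure_display)
    (T : measurableType dT) (F : T * d.-tuple R -> \bar R) :
  measurable_fun setT F -> (forall z, 0 <= F z)%E ->
  measurable_fun setT (fun t : T => haar_int (fun x => F (t, x))).
Proof.
elim: d dT T F => [|d IH] dT T F mF F0 /=.
  exact: measurable_fun_pair1 mF.
pose G (z : (T * R) * d.-tuple R) := F (z.1.1, cons_tuple z.1.2 z.2).
have mG : measurable_fun setT G.
  apply: (measurableT_comp mF); apply: measurable_fun_pair.
    exact: measurableT_comp measurable_fst measurable_fst.
  apply: measurable_cons; last exact: measurable_snd.
  exact: measurableT_comp measurable_snd measurable_fst.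
have mH := IH _ _ G mG (fun z => F0 _).
pose K (z : T * R) := (haar_int (fun x => G (z, x)) * (\1_(`[0%R, 1%R]) z.2)%:E)%E.
have mK : measurable_fun setT K.
  apply: emeasurable_funM => //; apply/measurable_EFinP.
  by apply: (measurableT_comp (measurable_indic _)); [exact: measurable_itv|exact: measurable_snd].
have K0 z : (0 <= K z)%E.
  by apply: mule_ge0; [apply: haar_int_ge0 => x; exact: F0|rewrite lee_fin].
have := @measurable_fun_fubini_tonelli_F _ _ T (measurableTypeR R) R lebesgue_measure K mK K0.
congr (measurable_fun _ _); apply/funext => t.
rewrite [RHS]integral_mkcond /fubini_F; apply: eq_integral => s _.
by rewrite epatch_indic.
Qed.

Lemma measurable_haar_int_cons (d : nat) (f : d.+1.-tuple R -> \bar R) :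
  measurable_fun setT f -> (forall x, 0 <= f x)%E ->
  measurable_fun setT (fun t => haar_int (fun x : d.-tuple R => f (cons_tuple t x))).
Proof.
move=> mf f0.
apply: (@measurable_haar_int d _ _ (fun z : R * d.-tuple R => f (cons_tuple z.1 z.2))) => //.
apply: (measurableT_comp mf).
by apply: measurable_cons; [exact: measurable_fst|exact: measurable_snd].
Qed.

Lemma measurable_cons_section (d : nat) (f : d.+1.-tuple R -> \bar R) (t : R) :
  measurable_fun setT f -> measurable_fun setT (fun x : d.-tuple R => f (cons_tuple t x)).
Proof.
move=> mf; apply: (measurableT_comp mf).
by apply: measurable_cons; [exact: measurable_cst|exact: measurable_id].
Qed.

Lemma haar_intD (d : nat) (f g : d.-tuple R -> \bar R) :
  measurable_fun setT f -> measurable_fun setT g ->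
  (forall x, 0 <= f x)%E -> (forall x, 0 <= g x)%E ->
  haar_int (fun x => f x + g x)%E = (haar_int f + haar_int g)%E.
Proof.
elim: d f g => [|d IH] f g mf mg f0 g0 //=.
have mI : measurable (`[0%R, 1%R] : set R) by exact: measurable_itv.
rewrite -ge0_integralD //.
- apply: eq_integral => t _.
  by rewrite IH //; exact: measurable_cons_section.
- by move=> t _; apply: haar_int_ge0.
- by apply: measurable_funTS; apply: measurable_haar_int_cons.
- by move=> t _; apply: haar_int_ge0.
- by apply: measurable_funTS; apply: measurable_haar_int_cons.
Qed.

Lemma haar_int_le (d : nat) (f g : d.-tuple R -> \bar R) :
  measurable_fun setT f -> measurable_fun setT g ->
  (forall x, 0 <= f x)%E -> (forall x, f x <= g x)%E ->
  (haar_int f <= haar_int g)%E.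
Proof.
elim: d f g => [|d IH] f g mf mg f0 fg //=.
have g0 x : (0 <= g x)%E by exact: le_trans (f0 x) (fg x).
apply: ge0_le_integral.
- exact: measurable_itv.
- by move=> t _; apply: haar_int_ge0.
- by apply: measurable_funTS; apply: measurable_haar_int_cons.
- by apply: measurable_funTS; apply: measurable_haar_int_cons.
- by move=> t _; apply: IH => //; exact: measurable_cons_section.
Qed.

Lemma eq_haar_int (d : nat) (f g : d.-tuple R -> \bar R) :
  f =1 g -> haar_int f = haar_int g.
Proof. by move=> /funext ->. Qed.

Lemma haar_int_cst (d : nat) (c : \bar R) : haar_int (fun _ : d.-tuple R => c) = c.
Proof.
elim: d => [|d IH] //=; rewrite IH integral_cst; last exact: measurable_itv.
by rewrite /= lebesgue_measure_itv /= lte_fin ltr01 oppr0 adde0 mule1.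
Qed.

Lemma haar_int_sum (d : nat) (I : Type) (s : seq I) (f : I -> d.-tuple R -> \bar R) :
  (forall i, measurable_fun setT (f i)) -> (forall i x, 0 <= f i x)%E ->
  haar_int (fun x => \sum_(i <- s) f i x)%E = (\sum_(i <- s) haar_int (f i))%E.
Proof.
move=> mf f0; elim: s => [|i s IH].
  by under eq_haar_int do rewrite big_nil; rewrite haar_int_cst big_nil.
under eq_haar_int do rewrite big_cons; rewrite big_cons haar_intD ?IH //.
  exact: emeasurable_sum.
by move=> x; apply: sume_ge0.
Qed.

(** The iterated integral runs over the last coordinates first. This serves integrands whose inner
    integral does not depend on the outer variables, here after a translation by [offset]. *)
Lemma haar_int_cat (m n : nat) (f : (m + n).-tuple R -> \bar R) (c : \bar R) :
  (forall y : m.-tuple R, haar_int (fun x : n.-tuple R => f (cat_tuple y x)) = c) ->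
  haar_int f = c.
Proof.
elim: m f => [|m IH] f fc.
  rewrite -[RHS](fc [tuple]); apply: eq_haar_int => x; congr f.
  exact: val_inj.
rewrite -[RHS](haar_int_cst 1 c) /=; apply: eq_integral => t _.
apply: IH => y; rewrite -[RHS](fc (cons_tuple t y)).
by apply: eq_haar_int => x; congr f; exact: val_inj.
Qed.

End HaarIntegral.

(** * Integrals of cosines *)

Section CosineIntegrals.
Context {R : realType}.
Implicit Types (t c : R).

Lemma integral01_derive (F f : R -> R) :
  continuous f -> (forall t, is_derive t (1 : R) F (f t)) ->
  (\int[lebesgue_measure]_(t in `[0%R, 1%R]) (f t)%:E)%E = (F 1 - F 0)%:E.
Proof.
move=> cf dF; rewrite (@continuous_FTC2 _ f F 0 1) //.
- exact: continuous_subspaceT.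
- have cF : continuous F.
    move=> t; apply: differentiable_continuous; apply/derivable1_diffP.
    exact: (@ex_derive _ _ _ _ _ _ _ (dF t)).
  split.
  + by move=> t _; exact: (@ex_derive _ _ _ _ _ _ _ (dF t)).
  + by apply: cvg_at_right_filter; exact: cF.
  + by apply: cvg_at_left_filter; exact: cF.
- by move=> t _; rewrite derive1E; exact: (@derive_val _ _ _ _ _ _ _ (dF t)).
Qed.

Lemma sinD2pin t (n : nat) : sin (2 * pi * n%:R + t) = sin t.
Proof.
have -> : 2 * pi * n%:R + t = t + pi *+ 2 *+ n.
  by rewrite -mulr_natr -[pi *+ 2]mulr_natr; ring.
exact: (periodicn (@sinD2pi R)).
Qed.

Lemma is_deriveMl (k : R) (F : R -> R) (x df : R) :
  is_derive x (1 : R) F df -> is_derive x (1 : R) (fun s => k * F s) (k * df).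
Proof. by move=> h; exact: (is_deriveZ k h). Qed.

Definition cos_prim (n c : R) : R -> R := fun t =>
  if n == 0 then cos c * t else (2 * pi * n)^-1 * sin (2 * pi * n * t + c).

Lemma is_derive_cos_prim (n c t : R) :
  is_derive t (1 : R) (cos_prim n c) (cos (2 * pi * n * t + c)).
Proof.
rewrite /cos_prim; case: eqP => [->|/eqP n0].
  rewrite mulr0 mul0r add0r -[X in is_derive _ _ _ X]mulr1.
  by apply: is_deriveMl; exact: is_derive_id.
set w := 2 * pi * n.
have w0 : w != 0 by rewrite !mulf_neq0 // ?gt_eqF ?pi_gt0.
have H : is_derive t (1 : R) (fun s : R => w * s + c) w.
  rewrite -[X in is_derive _ _ _ X](addr0 w) -[X in is_derive _ _ _ (X + 0)]mulr1.
  by apply: is_deriveD; apply: is_deriveMl; exact: is_derive_id.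
rewrite -[X in is_derive _ _ _ X](mulKf w0) [w * cos _]mulrC; apply: is_deriveMl.
Qed.

Lemma continuous_cos_affine (w c : R) : continuous (fun t => cos (w * t + c)).
Proof.
move=> t; apply: (@continuous_comp _ _ _ (fun t => w * t + c) cos).
  by apply: cvgD; [apply: cvgM; [exact: cvg_cst|exact: cvg_id]|exact: cvg_cst].
exact: continuous_cos.
Qed.

Lemma cos_prim01 (a b : nat) c :
  cos_prim (a%:R - b%:R) c 1 - cos_prim (a%:R - b%:R) c 0 = (a == b)%:R * cos c.
Proof.
rewrite /cos_prim subr_eq0 eqr_nat; case: eqP => _; first by rewrite mulr1 mulr0 subr0 mul1r.
rewrite mulr1 mulr0 add0r -mulrBr mul0r.
have -> : 2 * pi * (a%:R - b%:R) + c = 2 * pi * a%:R + (c - 2 * pi * b%:R) by ring.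
rewrite sinD2pin -[sin c](_ : sin (2 * pi * b%:R + (c - 2 * pi * b%:R)) = _); last by congr sin; ring.
by rewrite sinD2pin subrr mulr0.
Qed.

(** Differences of naturals represent integer frequencies. Two cosines cover both uses:
    orthogonality of characters (with [C = 0]) and the frequencies 1 and 2 of [majorant]. *)
Lemma integral01_cos (A B C : R) (a b a' b' : nat) c c' :
  (\int[lebesgue_measure]_(t in `[0%R, 1%R])
    (A + B * cos (2 * pi * (a%:R - b%:R) * t + c)
       + C * cos (2 * pi * (a'%:R - b'%:R) * t + c'))%:E)%E =
  (A + B * ((a == b)%:R * cos c) + C * ((a' == b')%:R * cos c'))%:E.
Proof.
pose n : R := a%:R - b%:R; pose n' : R := a'%:R - b'%:R.
pose f t := A + B * cos (2 * pi * n * t + c) + C * cos (2 * pi * n' * t + c').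
pose F t := A * t + B * cos_prim n c t + C * cos_prim n' c' t.
have cf : continuous f.
  move=> t; apply: cvgD; [apply: cvgD; [exact: cvg_cst|]|];
  by apply: cvgM; [exact: cvg_cst|exact: continuous_cos_affine].
have dF t : is_derive t (1 : R) F (f t).
  have H : is_derive t (1 : R) (fun t => A * t) A.
    by rewrite -[X in is_derive _ _ _ X]mulr1; apply: is_deriveMl; exact: is_derive_id.
  have HB := is_deriveMl B (is_derive_cos_prim n c t).
  have HC := is_deriveMl C (is_derive_cos_prim n' c' t).
  exact: (is_deriveD (is_deriveD H HB) HC).
rewrite (integral01_derive cf dF); congr EFin.
by rewrite -!cos_prim01 /F -/n -/n'; ring.
Qed.

(** An exponent in Z^d is encoded as a difference of two multi-indices, matching the shifted
    exponents [h i - s] used below. *)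
Definition phase (d : nat) (a b : 'I_d -> nat) (x : d.-tuple R) : R :=
  \sum_(j < d) ((a j)%:R - (b j)%:R) * tnth x j.

(** Orthogonality of characters. In the induction the contribution of the first coordinate is
    absorbed into the constant angle [c]. *)
Lemma haar_int_cos (d : nat) (a b : 'I_d -> nat) (A B c : R) :
  haar_int (fun x : d.-tuple R => (A + B * cos (2 * pi * phase a b x + c))%:E)
  = (A + B * ([forall j, a j == b j]%:R * cos c))%:E.
Proof.
elim: d a b c => [|d IH] a b c.
  rewrite /= /phase big_ord0 mulr0 add0r.
  by rewrite (_ : [forall j, a j == b j]) ?mul1r //; apply/forallP => -[].
pose a' j := a (lift ord0 j); pose b' j := b (lift ord0 j).
transitivity (\int[lebesgue_measure]_(t in `[0%R, 1%R])
  (A + B * [forall j, a' j == b' j]%:R * cos (2 * pi * ((a ord0)%:R - (b ord0)%:R) * t + c)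
   + 0 * cos (2 * pi * (0%:R - 0%:R) * t + 0))%:E)%E.
  apply: eq_integral => t _; rewrite mul0r addr0 -mulrA -IH; apply: eq_haar_int => x.
  congr (_ + _ * cos _)%:E; rewrite /phase big_ord_recl tnth0.
  under eq_bigr do rewrite tnthS.
  by rewrite /a' /b'; ring.
rewrite integral01_cos mul0r addr0 -!mulrA [_ * (_ * cos c)]mulrA -natrM mulnb.
congr (_ + _ * (_%:R * _))%:E; congr nat_of_bool.
apply/andP/forallP => [[/forallP h h0] j|h].
  by case: (unliftP ord0 j) => [k ->|-> //]; exact: h.
by split => //; apply/forallP => j; exact: h.
Qed.

Lemma measurable_phase (d : nat) (a b : 'I_d -> nat) :
  measurable_fun setT (phase a b).
Proof.
apply: measurable_sum => j; apply: measurable_funM => //; exact: measurable_tnth.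
Qed.

Lemma measurable_cos_phase (d : nat) (a b : 'I_d -> nat) (c : R) :
  measurable_fun setT (fun x => cos (2 * pi * phase a b x + c)).
Proof.
apply: (@measurableT_comp _ _ _ _ _ _ (@cos R)).
  exact: (continuous_measurable_fun (@continuous_cos R)).
by apply: measurable_funD => //; apply: measurable_funM => //; exact: measurable_phase.
Qed.

(** [haar_intR] is a difference of integrals of positive and negative parts, while additivity is
    available for nonnegative functions. Adding 1 to each of the M cosines gives f^+ + M = sum (1 +
    cos) + f^-, an identity between nonnegative functions. *)
Lemma haar_intR_sum_cos (d : nat) (I : finType) (a b : I -> 'I_d -> nat) (c : R) :
  haar_intR (fun x : d.-tuple R => \sum_i cos (2 * pi * phase (a i) (b i) x + c))
  = \sum_i [forall j, a i j == b i j]%:R * cos c.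
Proof.
set f := (fun x => \sum_i _); rewrite /haar_intR; set S := (RHS).
pose M : R := #|I|%:R.
have fM x : `|f x| <= M.
  apply: le_trans (ler_norm_sum _ _ _) _.
  apply: (@le_trans _ _ (\sum_(i : I) 1)); last by rewrite sumr_const.
  by apply: ler_sum => i _; rewrite ler_norml cos_geN1 cos_le1.
have mf : measurable_fun setT f by apply: measurable_sum => i; exact: measurable_cos_phase.
set fp := (fun x => (Num.max (f x) 0)%:E); set fn := (fun x => (Num.max (- f x) 0)%:E).
have mfp : measurable_fun setT fp by apply/measurable_EFinP; exact: measurable_funrpos.
have mfn : measurable_fun setT fn by apply/measurable_EFinP; exact: measurable_funrneg.
have fp0 x : (0 <= fp x)%E by rewrite lee_fin le_max lexx orbT.
have fn0 x : (0 <= fn x)%E by rewrite lee_fin le_max lexx orbT.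
have M0 : 0 <= M by exact: ler0n.
have fin (g : d.-tuple R -> \bar R) : measurable_fun setT g -> (forall x, 0 <= g x)%E ->
    (forall x, g x <= M%:E)%E -> haar_int g \is a fin_num.
  move=> mg g0 gM; rewrite ge0_fin_numE; last exact: haar_int_ge0.
  apply: (@le_lt_trans _ _ M%:E); last exact: ltry.
  by rewrite -(haar_int_cst d M%:E); apply: haar_int_le.
have fpfin : haar_int fp \is a fin_num.
  apply: fin => // x; rewrite lee_fin ge_max M0 andbT.
  by apply: le_trans (fM x); exact: ler_norm.
have fnfin : haar_int fn \is a fin_num.
  apply: fin => // x; rewrite lee_fin ge_max M0 andbT.
  by apply: le_trans (fM x); rewrite -normrN; exact: ler_norm.
pose h i x : \bar R := (1 + 1 * cos (2 * pi * phase (a i) (b i) x + c))%:E.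
have mh i : measurable_fun setT (h i).
  apply/measurable_EFinP; apply: measurable_funD => //.
  by apply: measurable_funM => //; exact: measurable_cos_phase.
have h0 i x : (0 <= h i x)%E by rewrite lee_fin mul1r -lerBlDl sub0r cos_geN1.
have : (haar_int fp + M%:E = (S + M)%:E + haar_int fn)%E.
  have -> : ((S + M)%:E = haar_int (fun x => \sum_i h i x))%E.
    rewrite haar_int_sum //; under eq_bigr do rewrite haar_int_cos.
    rewrite sumEFin; congr EFin; rewrite big_split /= sumr_const addrC; congr (_ + _).
    by apply: eq_bigr => i _; rewrite mul1r.
  rewrite -(haar_int_cst d M%:E) -!haar_intD //; last 2 first.
  - exact: emeasurable_sum.
  - by move=> x; exact: sume_ge0.
  apply: eq_haar_int => x; rewrite /fp /fn sumEFin -!EFinD; congr EFin.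
  rewrite big_split /= sumr_const.
  under eq_bigr do rewrite mul1r.
  rewrite -/(f x) -/M; case: (leP 0 (f x)) => fx.
    by rewrite max_r ?oppr_le0 // addr0 addrC.
  by rewrite max_l ?oppr_ge0 ?(ltW fx) // addrK add0r.
rewrite -(fineK fpfin) -(fineK fnfin) -!EFinD => -[].
by move=> E; apply/eqP; rewrite subr_eq; apply/eqP; lra.
Qed.

End CosineIntegrals.

(** * Riesz projection of trigonometric polynomials *)

Section TrigonometricPolynomials.
Context {R : realType}.

Definition trigsum (d : nat) (I : finType) (h : I -> 'I_d -> nat)
    (s : 'I_d -> nat) (x : d.-tuple R) : R[i] :=
  \sum_i expi (phase (h i) s x).

Lemma expiD (s t : R) : expi (s + t) = expi s * expi t.
Proof.
rewrite /expi mulrDr cosD sinD; apply/eqP; rewrite eq_complex /= eqxx /=.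
by apply/eqP; ring.
Qed.

Lemma Re_sum (I : finType) (f : I -> R[i]) :
  complex.Re (\sum_i f i) = \sum_i complex.Re (f i).
Proof. exact: raddf_sum. Qed.

Lemma Im_sum (I : finType) (f : I -> R[i]) :
  complex.Im (\sum_i f i) = \sum_i complex.Im (f i).
Proof. exact: raddf_sum. Qed.

Lemma fourier_trigsum (d : nat) (I : finType) (h : I -> 'I_d -> nat)
    (s alpha : 'I_d -> nat) :
  fourier (trigsum h s) alpha
  = \sum_i [forall j, h i j == (s j + alpha j)%N]%:R.
Proof.
have E x : trigsum h s x * expi (- \sum_(j < d) (alpha j)%:R * tnth x j)
    = \sum_i expi (phase (h i) (fun j => s j + alpha j)%N x).
  rewrite mulr_suml; apply: eq_bigr => i _; rewrite -expiD; congr expi.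
  rewrite /phase -sumrN -big_split; apply: eq_bigr => j _ /=.
  by rewrite natrD; ring.
(* Imaginary parts use sin u = cos (u - pi / 2), so that the cosine lemma serves both components. *)
have -> : fourier (trigsum h s) alpha
   = ((\sum_i [forall j, h i j == (s j + alpha j)%N]%:R * cos 0) +i*
      (\sum_i [forall j, h i j == (s j + alpha j)%N]%:R * cos (- (pi / 2))))%C.
  rewrite -!haar_intR_sum_cos /fourier; congr (_ +i* _)%C; congr haar_intR;
    apply/funext => x; rewrite E ?Re_sum ?Im_sum; apply: eq_bigr => i _ /=.
    by rewrite addr0.
  by rewrite cosBpihalf.
rewrite cos0 cosN cos_pihalf.
under eq_bigr do rewrite mulr1.
rewrite [X in (_ +i* X)%C]big1 => [|i _]; last by rewrite mulr0.
transitivity (real_complex R (\sum_i [forall j, h i j == (s j + alpha j)%N]%:R)) => //.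
rewrite rmorph_sum.
by apply: eq_bigr => i _; exact: (rmorph_nat (real_complex R)).
Qed.

Lemma riesz_partial_trigsum (d : nat) (I : finType) (h : I -> 'I_d -> nat)
    (s : 'I_d -> nat) (z : 'I_d -> R[i]) (N : nat) :
  (forall i j, (h i j < N)%N) ->
  riesz_partial (trigsum h s) N z =
  \sum_(i | [forall j, s j <= h i j]%N) \prod_j z j ^+ (h i j - s j).
Proof.
move=> hN; rewrite /riesz_partial.
under eq_bigr do rewrite fourier_trigsum mulr_suml.
rewrite exchange_big [RHS]big_mkcond; apply: eq_bigr => i _ /=.
case: ifPn => [/forallP sh|/forallPn[j sh]]; last first.
  apply: big1 => a _; case: forallP => [/(_ j)/eqP e|]; last by rewrite mul0r.
  by move: sh; rewrite e leq_addr.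
have lt j : (h i j - s j < N)%N by apply: leq_ltn_trans (hN i j); exact: leq_subr.
(* The only multi-index that receives a contribution from [i] is [h i - s]. *)
pose a0 : {ffun 'I_d -> 'I_N} := [ffun j => Ordinal (lt j)].
rewrite (bigD1 a0) //= [X in _ + X]big1 ?addr0 => [|a aa0].
  rewrite (_ : [forall j, _]) ?mul1r; last first.
    by apply/forallP => j; rewrite ffunE /= subnKC.
  by apply: eq_bigr => j _; rewrite ffunE.
case: forallP => [H|]; last by rewrite mul0r.
case/eqP: aa0; apply/ffunP => j; apply/val_inj; rewrite ffunE /=.
by rewrite (eqP (H j)) addKn.
Qed.

(** The partial sums are constant as soon as [N] exceeds every entry of every [h i], so the limit is
    a finite sum. *)
Lemma riesz_trigsum (d : nat) (I : finType) (h : I -> 'I_d -> nat)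
    (s : 'I_d -> nat) (z : 'I_d -> R[i]) :
  riesz (trigsum h s) z =
  \sum_(i | [forall j, s j <= h i j]%N) \prod_j z j ^+ (h i j - s j).
Proof.
rewrite /riesz; set S := RHS; pose M := (\max_i \max_j h i j).+1.
have HM N : (M <= N)%N -> riesz_partial (trigsum h s) N z = S.
  move=> MN; apply: riesz_partial_trigsum => i j; apply: leq_trans MN.
  rewrite ltnS; apply: (@leq_trans (\max_j h i j)); first exact: leq_bigmax.
  exact: (@leq_bigmax _ (fun i => \max_j h i j)).
have lim_const (f : R[i] -> R) : limn (fun N => f (riesz_partial (trigsum h s) N z)) = f S.
  apply: lim_near_cst; first exact: Rhausdorff.
  by exists M => // N /= MN; rewrite HM.
by rewrite !lim_const; case: S {HM lim_const}.
Qed.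

Lemma sqr_cabs (z : R[i]) : cabs z ^+ 2 = complex.Re z ^+ 2 + complex.Im z ^+ 2.
Proof. by rewrite sqr_sqrtr // addr_ge0 ?sqr_ge0. Qed.

Lemma cabs_ge0 (z : R[i]) : 0 <= cabs z.
Proof. exact: sqrtr_ge0. Qed.

Lemma cabsM (z w : R[i]) : cabs (z * w) = cabs z * cabs w.
Proof.
rewrite /cabs -sqrtrM ?addr_ge0 ?sqr_ge0 //; congr Num.sqrt.
by case: z w => [a b] [c e] /=; ring.
Qed.

Lemma cabs1 : cabs (1 : R[i]) = 1.
Proof. by rewrite /cabs /= expr0n addr0 expr1n sqrtr1. Qed.

Lemma cabs_prod (I : finType) (f : I -> R[i]) : cabs (\prod_i f i) = \prod_i cabs (f i).
Proof. exact: (big_morph _ cabsM cabs1). Qed.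

Lemma cabsX (z : R[i]) (n : nat) : cabs (z ^+ n) = cabs z ^+ n.
Proof. by elim: n => [|n IH]; rewrite ?expr0 ?cabs1 // !exprS cabsM IH. Qed.

Lemma cabs_expi (t : R) : cabs (expi t) = 1.
Proof. by rewrite /cabs /= cos2Dsin2 sqrtr1. Qed.

Lemma cabs_real (r : R) : 0 <= r -> cabs (r%:C)%C = r.
Proof. by move=> r0; rewrite /cabs /= expr0n addr0 sqrtr_sqr ger0_norm. Qed.

Lemma cabs_parallelogram (z w : R[i]) :
  cabs (z + w) ^+ 2 + cabs (z - w) ^+ 2 = 2 * (cabs z ^+ 2 + cabs w ^+ 2).
Proof. by rewrite !sqr_cabs; case: z w => [a b] [c e] /=; ring. Qed.

Lemma sqr_cabs_expiD (s t : R) :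
  cabs (expi s + expi t) ^+ 2 = 2 * (1 + cos (2 * pi * (s - t))).
Proof.
rewrite sqr_cabs /= mulrBr cosB.
have := cos2Dsin2 (2 * pi * s); have := cos2Dsin2 (2 * pi * t).
nra.
Qed.

End TrigonometricPolynomials.

(** * Rudin-Shapiro signs and frequencies in convex position *)

Section RudinShapiro.
Context {R : realType}.

Lemma big_tuple_cons (V : nmodType) (T : finType) (k : nat)
    (F : k.+1.-tuple T -> V) :
  \sum_a F a = \sum_t \sum_(a : k.-tuple T) F (cons_tuple t a).
Proof.
rewrite pair_big /= (reindex (fun p : T * k.-tuple T => cons_tuple p.1 p.2)) //=.
exists (fun a => (thead a, [tuple of behead a])) => [[t a] _|a _] /=.
  by congr pair; apply: val_inj.
by rewrite [RHS]tuple_eta; apply: val_inj.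
Qed.

Lemma sum_prod_tuple (k : nat) (w : 'I_k -> bool -> R[i]) :
  \sum_(a : k.-tuple bool) \prod_j w j (tnth a j) = \prod_j (w j false + w j true).
Proof.
elim: k w => [|k IH] w.
  rewrite big_ord0 (eq_bigr (fun=> 1)) => [|a _]; last by rewrite big_ord0.
  by rewrite sumr_const card_tuple.
rewrite big_tuple_cons big_bool big_ord_recl -(IH (fun j => w (lift ord0 j))).
rewrite mulrDl !mulr_sumr addrC.
congr (_ + _); apply: eq_bigr => a _; rewrite big_ord_recl tnth0;
  by congr (_ * _); apply: eq_bigr => j _; rewrite tnthS.
Qed.

(* The parity of the number of pairs of consecutive [true]'s in [q :: s]. *)
Fixpoint rs_sign (q : bool) (s : seq bool) : bool :=
  if s is b :: s' then (q && b) (+) rs_sign b s' else false.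

(** [q] plays the role of a letter preceding [a]; the values [false] and [true] give the
    Rudin-Shapiro pair P, Q. Arbitrary weights allow evaluation inside the polydisc as well as on
    the torus. *)
Definition rs_poly (q : bool) (k : nat) (w : 'I_k -> bool -> R[i]) : R[i] :=
  \sum_(a : k.-tuple bool) (-1) ^+ rs_sign q a * \prod_j w j (tnth a j).

(** Splitting off the first letter gives the Rudin-Shapiro recursion: P' = w_0 P + w_1 Q and Q' =
    w_0 P - w_1 Q. *)
Lemma rs_polyS (q : bool) (k : nat) (w : 'I_k.+1 -> bool -> R[i]) :
  let w' j := w (lift ord0 j) in
  rs_poly q w = w ord0 false * rs_poly false w'
                + (-1) ^+ q * (w ord0 true * rs_poly true w').
Proof.
rewrite /rs_poly /= big_tuple_cons big_bool addrC !mulr_sumr.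
congr (_ + _); apply: eq_bigr => a _; rewrite big_ord_recl tnth0 /=;
  under eq_bigr do rewrite tnthS.
  by rewrite andbT signr_addb; ring.
by rewrite andbF /= mulrCA.
Qed.

(** By the parallelogram identity |P'|^2 + |Q'|^2 = 2 (|w_0|^2 |P|^2 + |w_1|^2 |Q|^2). The bound
    [rho] replaces modulus 1 because the Hardy norm is computed at radii r < 1. *)
Lemma rs_poly_lower (k : nat) (w : 'I_k -> bool -> R[i]) (rho : R) :
  0 <= rho -> (forall j b, rho <= cabs (w j b)) ->
  2 * (2 * rho ^+ 2) ^+ k <= cabs (rs_poly false w) ^+ 2 + cabs (rs_poly true w) ^+ 2.
Proof.
move=> rho0; elim: k w => [|k IH] w hw.
  have E q : rs_poly q w = 1.
    rewrite /rs_poly (eq_bigr (fun=> 1)) => [|a _]; last by rewrite big_ord0 tuple0 mulr1.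
    by rewrite sumr_const card_tuple.
  by rewrite !E cabs1 expr1n expr0; lra.
have -> : 2 * (2 * rho ^+ 2) ^+ k.+1 = 2 * (rho ^+ 2 * (2 * (2 * rho ^+ 2) ^+ k)).
  by rewrite exprS; ring.
have := IH _ (fun j b => hw (lift ord0 j) b).
set L := 2 * _ ^+ k => PQL; move: PQL.
rewrite !rs_polyS /= expr0 expr1 mul1r mulN1r cabs_parallelogram !cabsM !exprMn.
set P := cabs (rs_poly false _); set Q := cabs (rs_poly true _) => PQ.
have sq b : rho ^+ 2 <= cabs (w ord0 b) ^+ 2 by rewrite lerXn2r ?nnegrE ?cabs_ge0.
have P0 : 0 <= P ^+ 2 by exact: sqr_ge0.
have Q0 : 0 <= Q ^+ 2 by exact: sqr_ge0.
apply: (@le_trans _ _ (2 * (rho ^+ 2 * (P ^+ 2 + Q ^+ 2)))); last first.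
  by rewrite ler_pM2l // mulrDr lerD // ler_wpM2r // -?exprMn.
by rewrite ler_pM2l // ler_wpM2l ?sqr_ge0.
Qed.

Definition rs_set (k : nat) (qc : bool * bool) : {set k.-tuple bool} :=
  [set a : k.-tuple bool | rs_sign qc.1 a == qc.2].

(** Each of P, Q is the difference of its two sign parts, and |x - y|^2 <= 2 (|x|^2 + |y|^2). The
    factor 2 lost here is the one gained in [rs_poly_lower]. *)
Lemma rs_set_lower (k : nat) (w : 'I_k -> bool -> R[i]) (rho : R) :
  0 <= rho -> (forall j b, rho <= cabs (w j b)) ->
  (2 * rho ^+ 2) ^+ k <=
    \sum_qc cabs (\sum_(a in rs_set k qc) \prod_j w j (tnth a j)) ^+ 2.
Proof.
move=> rho0 hw; rewrite -(ler_pM2l (ltr0Sn R 1)).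
apply: le_trans (rs_poly_lower rho0 hw) _.
set f := fun qc : bool * bool => \sum_(a in rs_set k qc) \prod_j w j (tnth a j).
have E q : rs_poly q w = f (q, false) - f (q, true).
  rewrite /rs_poly (bigID (fun a : k.-tuple bool => ~~ rs_sign q a)) /= -sumrN.
  congr (_ + _); apply: eq_big => a; rewrite ?inE ?eqbF_neg ?negbK ?eqb_id //=.
    by move=> /negbTE ->; rewrite mul1r.
  by move=> ->; rewrite mulN1r.
have B q : cabs (rs_poly q w) ^+ 2 <= 2 * (cabs (f (q, false)) ^+ 2 + cabs (f (q, true)) ^+ 2).
  by rewrite -cabs_parallelogram E lerDr sqr_ge0.
apply: le_trans (lerD (B false) (B true)) _.
rewrite -(pair_big xpredT xpredT (fun q c => cabs (f (q, c)) ^+ 2)) /= !big_bool /=.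
lra.
Qed.

End RudinShapiro.

Section Frequencies.
Context {R : realType} (k : nat).

Local Notation M := #|{: k.-tuple bool}|.

(* The Hamming distances to all the vertices of the cube come first; they put
   the frequencies in convex position. *)
Definition freq (a : k.-tuple bool) (i : 'I_(M + k)) : nat :=
  match fintype.split i with
  | inl b => (\sum_(j < k) (tnth a j != tnth (enum_val b) j))%N
  | inr j => tnth a j
  end.

Definition freq_shift (B : {set k.-tuple bool}) (i : 'I_(M + k)) : nat :=
  if fintype.split i is inl b then enum_val b \notin B else false.

(** If [a] is outside [B], then at the coordinate of [a] the shift is 1 while the Hamming distance
    is 0. If [a] is in [B], every vertex outside [B] has distance at least 1 from [a]. *)
Lemma freq_shift_le (B : {set k.-tuple bool}) (a : k.-tuple bool) :
  [forall i, freq_shift B i <= freq a i]%N = (a \in B).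
Proof.
apply/forallP/idP => [/(_ (lshift k (enum_rank a)))|aB i].
  rewrite /freq_shift /freq (unsplitK (inl (enum_rank a))) enum_rankK.
  by rewrite big1 => [|j _]; rewrite ?eqxx // leqn0 eqb0 negbK.
rewrite /freq_shift /freq; case: fintype.split => // b; case: (boolP (enum_val b \in B)) => //= bB.
rewrite lt0n; apply/negP; rewrite sum_nat_eq0 => /forallP H.
case/negP: bB; rewrite (_ : enum_val b = a) //; apply: eq_from_tnth => j.
by apply/esym/eqP; have := H j; rewrite eqb0 negbK.
Qed.

(** A Hamming distance is a sum over letters, so the monomial with exponent [freq a] splits into one
    factor per letter; this is the factor for letter [j] with value [b]. *)
Definition cube_factor (z : 'I_(M + k) -> R[i]) (j : 'I_k) (b : bool) : R[i] :=
  (\prod_(c < M) z (lshift k c) ^+ (b != tnth (enum_val c) j))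
  * z (rshift M j) ^+ b.

Lemma prod_freq (z : 'I_(M + k) -> R[i]) (a : k.-tuple bool) :
  \prod_i z i ^+ freq a i = \prod_j cube_factor z j (tnth a j).
Proof.
rewrite big_split_ord big_split /=; congr (_ * _).
  rewrite exchange_big; apply: eq_bigr => c _.
  by rewrite /freq (unsplitK (inl c)) /= expr_sum.
by apply: eq_bigr => j _; rewrite /freq (unsplitK (inr j)).
Qed.

Lemma cube_factor_lower (z : 'I_(M + k) -> R[i]) (r : R) (j : 'I_k) (b : bool) :
  0 <= r <= 1 -> (forall i, cabs (z i) = r) -> r ^+ M.+1 <= cabs (cube_factor z j b).
Proof.
move=> /andP[r0 r1] zr; rewrite cabsM cabs_prod cabsX zr exprSr.
have X (c : bool) : r <= r ^+ c by case: c.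
apply: ler_pM => //; first exact: exprn_ge0.
rewrite -[X in r ^+ X]card_ord -prodr_const; apply: ler_prod => c _.
by rewrite r0 cabsX zr X.
Qed.

(** Multiplying the projection by the monomial of exponent [freq_shift B] restores the monomials of
    exponent [freq a], and this multiplier has modulus at most 1 in the closed polydisc. *)
Lemma cabs_riesz_lower (B : {set k.-tuple bool}) (z : 'I_(M + k) -> R[i]) :
  (forall i, cabs (z i) <= 1) ->
  cabs (\sum_(a in B) \prod_j cube_factor z j (tnth a j))
  <= cabs (riesz (trigsum freq (freq_shift B)) z).
Proof.
move=> z1; rewrite riesz_trigsum.
have -> : \sum_(a in B) \prod_j cube_factor z j (tnth a j) =
    (\prod_i z i ^+ freq_shift B i) *
    \sum_(a | [forall i, freq_shift B i <= freq a i]%N) \prod_i z i ^+ (freq a i - freq_shift B i).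
  rewrite mulr_sumr; apply: eq_big => [a|a aB]; first by rewrite freq_shift_le.
  move: aB; rewrite -freq_shift_le => /forallP aB.
  rewrite -prod_freq -big_split; apply: eq_bigr => i _ /=.
  by rewrite -exprD subnKC.
rewrite cabsM ler_piMl ?cabs_ge0 // cabs_prod; apply: prodr_ile1 => i _.
by rewrite cabs_ge0 cabsX exprn_ile1 ?cabs_ge0.
Qed.

End Frequencies.

(** * The [L^q] upper bound *)

Section UpperBound.
Context {R : realType}.

(** Weighted arithmetic-geometric mean for y^q = y^(2 - q) (y^2)^(q - 1), obtained by dividing by
    y^q and using exp t >= 1 + t. *)
Lemma powR_interpolation (q y : R) :
  1 <= q < 2 -> 0 <= y -> y `^ q <= (2 - q) * y + (q - 1) * y ^+ 2.
Proof.
move=> /andP[q1 q2]; rewrite le_eqVlt => /predU1P[<-|y0].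
  by rewrite powR0 ?mulr0 ?expr0n ?mulr0 ?addr0 // gt_eqF // (lt_le_trans ltr01).
rewrite -{2 3}(lnK y0) /powR gt_eqF // -expRM_natl.
have e1 := expR_ge1Dx ((1 - q) * ln y); have e2 := expR_ge1Dx ((2 - q) * ln y).
have -> : expR (ln y) = expR (q * ln y) * expR ((1 - q) * ln y).
  by rewrite -expRD; congr expR; ring.
have -> : expR (2%:R * ln y) = expR (q * ln y) * expR ((2 - q) * ln y).
  by rewrite -expRD; congr expR; ring.
set m := expR (q * ln y).
have m0 : 0 < m by exact: expR_gt0.
(* The terms linear in [ln y] cancel: (2 - q)(1 - q) + (q - 1)(2 - q) = 0. *)
have : 1 <= (2 - q) * expR ((1 - q) * ln y) + (q - 1) * expR ((2 - q) * ln y).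
  have h1 : (2 - q) * (1 + (1 - q) * ln y) <= (2 - q) * expR ((1 - q) * ln y).
    by rewrite ler_wpM2l // subr_ge0 ltW.
  have h2 : (q - 1) * (1 + (2 - q) * ln y) <= (q - 1) * expR ((2 - q) * ln y).
    by rewrite ler_wpM2l // subr_ge0.
  nra.
rewrite -(ler_pM2l m0) mulr1 => /le_trans; apply.
by rewrite le_eqVlt; apply/predU1P; left; ring.
Qed.

(** The Taylor coefficient -1/8 would fail for u > 0. With -1/16 the square of the right side
    exceeds 1 + u by u^2/8 - u^3/16 + u^4/256, which is nonnegative on [-1, 1]. *)
Lemma sqrt1D_le (u : R) : -1 <= u <= 1 -> Num.sqrt (1 + u) <= 1 + u / 2 - u ^+ 2 / 16.
Proof.
move=> /andP[u1 u2].
have h0 : 0 <= 1 + u / 2 - u ^+ 2 / 16 by nra.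
rewrite -(ger0_norm h0) -sqrtr_sqr ler_wsqrtr //.
have u20 : 0 <= u ^+ 2 by exact: sqr_ge0.
have u40 : 0 <= u ^+ 2 * u ^+ 2 by exact: mulr_ge0.
have : u ^+ 2 * u <= u ^+ 2 * 1 by rewrite ler_wpM2l.
nra.
Qed.

(* With [u] the cosine and [y = sqrt (1 + u)], combine
   [y ^ q <= (2 - q) y + (q - 1) y^2] with [y <= 1 + u / 2 - u^2 / 16]: the
   quadratic term makes the mean over a period less than [sqrt 2 ^ q]. *)
Definition majorant (q t : R) : R :=
  Num.sqrt 2 `^ q *
  (1 + q / 2 * cos (2 * pi * t) - (2 - q) / 16 * cos (2 * pi * t) ^+ 2).

Lemma powR_le_majorant (q v t : R) : 1 <= q < 2 -> 0 <= v ->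
  v ^+ 2 = 2 * (1 + cos (2 * pi * t)) -> v `^ q <= majorant q t.
Proof.
move=> q12 v0 vE; set u := cos _ in vE.
have u1 : -1 <= u <= 1 by rewrite cos_geN1 cos_le1.
have -> : v = Num.sqrt 2 * Num.sqrt (1 + u).
  by rewrite -sqrtrM // -vE sqrtr_sqr ger0_norm.
rewrite powRM ?sqrtr_ge0 // /majorant ler_wpM2l ?powR_ge0 //.
apply: le_trans (powR_interpolation q12 (sqrtr_ge0 _)) _.
rewrite sqr_sqrtr; last by case/andP: u1; lra.
have := sqrt1D_le u1; rewrite -/u; case/andP: q12 => q1 q2.
set s := Num.sqrt _ => hs.
have : (2 - q) * s <= (2 - q) * (1 + u / 2 - u ^+ 2 / 16).
  by rewrite ler_wpM2l // subr_ge0 ltW.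
nra.
Qed.

Lemma integral_majorant (q A c : R) :
  (\int[lebesgue_measure]_(t in `[0%R, 1%R]) (A * majorant q (t + c))%:E)%E
  = (A * (Num.sqrt 2 `^ q * (1 - (2 - q) / 32)))%:E.
Proof.
set L := Num.sqrt 2 `^ q.
(* Linearizing cos^2, whose mean is 1/2, turns (2 - q)/16 into the loss (2 - q)/32 and leaves a
   cosine of frequency 2. *)
have E t : A * majorant q (t + c) =
   A * L * (1 - (2 - q) / 32)
   + A * L * (q / 2) * cos (2 * pi * (1%:R - 0%:R) * t + 2 * pi * c)
   + - (A * L * ((2 - q) / 32)) * cos (2 * pi * (2%:R - 0%:R) * t + 4 * pi * c).
  have -> : 2 * pi * (1%:R - 0%:R) * t + 2 * pi * c = 2 * pi * (t + c) by ring.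
  have -> : 2 * pi * (2%:R - 0%:R) * t + 4 * pi * c
    = 2 * pi * (t + c) + 2 * pi * (t + c) by ring.
  rewrite cosD /majorant -/L.
  have -> : sin (2 * pi * (t + c)) * sin (2 * pi * (t + c))
      = 1 - cos (2 * pi * (t + c)) ^+ 2 by rewrite -sin2cos2 expr2.
  by field.
under eq_integral do rewrite E.
by rewrite integral01_cos !mul0r !mulr0 !addr0 mulrA.
Qed.

Lemma haar_int_prod_shift (k : nat) (g : R -> R) (J : R) (c : 'I_k -> R) (A : R) :
  (forall A c, \int[lebesgue_measure]_(t in `[0%R, 1%R]) (A * g (t + c))%:E
               = (A * J)%:E)%E ->
  haar_int (fun x : k.-tuple R => (A * \prod_j g (tnth x j + c j))%:E)
  = (A * J ^+ k)%:E.
Proof.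
move=> gJ; elim: k c A => [|k IH] c A; first by rewrite /= big_ord0 expr0.
transitivity (\int[lebesgue_measure]_(t in `[0%R, 1%R])
    (A * J ^+ k * g (t + c ord0))%:E)%E; last first.
  by rewrite gJ exprSr mulrA.
apply: eq_integral => t _; rewrite mulrAC -(IH (fun j => c (lift ord0 j))); apply: eq_haar_int => x.
rewrite big_ord_recl tnth0 mulrA; congr (_ * _)%:E; apply: eq_bigr => j _.
by rewrite tnthS.
Qed.

Lemma expi0 : expi (0 : R) = 1.
Proof. by rewrite /expi mulr0 cos0 sin0. Qed.

Lemma expi_sum (I : finType) (f : I -> R) : expi (\sum_i f i) = \prod_i expi (f i).
Proof. exact: (big_morph _ (@expiD R) expi0). Qed.

Lemma expi_natl (n : nat) (t : R) : expi (n%:R * t) = expi t ^+ n.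
Proof.
elim: n => [|n IH]; first by rewrite mul0r expi0 expr0.
by rewrite exprS -IH -expiD; congr expi; rewrite -natr1; ring.
Qed.

Lemma powR_prod (I : finType) (f : I -> R) (q : R) :
  (forall i, 0 <= f i) -> (\prod_i f i) `^ q = \prod_i f i `^ q.
Proof.
move=> f0.
suff [] : 0 <= \prod_i f i /\ (\prod_i f i) `^ q = \prod_i f i `^ q by [].
apply: (big_ind2 (fun a b => 0 <= a /\ a `^ q = b)) => [|a b c e [a0 <-] [c0 <-]|i _].
- by rewrite powR1.
- by rewrite mulr_ge0 // powRM.
- by split.
Qed.

(** * Measurability of trigonometric polynomials and their projections *)

Definition cmeasurable (d : nat) (f : d.-tuple R -> R[i]) :=
  measurable_fun setT (fun x => complex.Re (f x)) /\
  measurable_fun setT (fun x => complex.Im (f x)).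

Lemma cmeasurable_cst (d : nat) (z : R[i]) : cmeasurable (fun _ : d.-tuple R => z).
Proof. by split; exact: measurable_cst. Qed.

Lemma cmeasurableD (d : nat) (f g : d.-tuple R -> R[i]) :
  cmeasurable f -> cmeasurable g -> cmeasurable (fun x => f x + g x).
Proof.
move=> [fr fi] [gr gi]; split.
  by under eq_fun do rewrite raddfD; exact: measurable_funD.
by under eq_fun do rewrite raddfD; exact: measurable_funD.
Qed.

Lemma cmeasurableM (d : nat) (f g : d.-tuple R -> R[i]) :
  cmeasurable f -> cmeasurable g -> cmeasurable (fun x => f x * g x).
Proof.
move=> [fr fi] [gr gi].
have E x : f x * g x =
    ((complex.Re (f x) * complex.Re (g x) - complex.Im (f x) * complex.Im (g x))
     +i* (complex.Re (f x) * complex.Im (g x) + complex.Im (f x) * complex.Re (g x)))%C.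
  by case: (f x) (g x) => [a b] [a' b'].
split; under eq_fun do rewrite E /=.
  by apply: measurable_funB; exact: measurable_funM.
by apply: measurable_funD; exact: measurable_funM.
Qed.

Lemma cmeasurable_big (d : nat) (op : R[i] -> R[i] -> R[i]) (idx : R[i])
    (I : Type) (s : seq I) (P : pred I) (f : I -> d.-tuple R -> R[i]) :
  (forall f g : d.-tuple R -> R[i], cmeasurable f -> cmeasurable g ->
     cmeasurable (fun x => op (f x) (g x))) ->
  (forall i, cmeasurable (f i)) ->
  cmeasurable (fun x => \big[op/idx]_(i <- s | P i) f i x).
Proof.
move=> mop mf; elim: s => [|i s IH].
  rewrite (_ : (fun x => _) = (fun=> idx)); first exact: cmeasurable_cst.
  by apply/funext => x; rewrite big_nil.
case Pi: (P i).
  rewrite (_ : (fun x => _) = (fun x => op (f i x) (\big[op/idx]_(i <- s | P i) f i x))).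
    exact: mop.
  by apply/funext => x; rewrite big_cons Pi.
rewrite (_ : (fun x => _) = (fun x => \big[op/idx]_(i <- s | P i) f i x)) //.
by apply/funext => x; rewrite big_cons Pi.
Qed.

Lemma cmeasurableX (d : nat) (f : d.-tuple R -> R[i]) (n : nat) :
  cmeasurable f -> cmeasurable (fun x => f x ^+ n).
Proof.
move=> mf; elim: n => [|n IH]; first exact: cmeasurable_cst.
by under eq_fun do rewrite exprS; exact: cmeasurableM.
Qed.

Lemma cmeasurable_expi (d : nat) (f : d.-tuple R -> R) :
  measurable_fun setT f -> cmeasurable (fun x => expi (f x)).
Proof.
move=> mf; have m2f : measurable_fun setT (fun x => 2 * pi * f x) by exact: measurable_funM.
split=> /=.
  exact: (measurableT_comp (continuous_measurable_fun (@continuous_cos R))).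
exact: (measurableT_comp (continuous_measurable_fun (@continuous_sin R))).
Qed.

Lemma cmeasurable_trigsum (d : nat) (I : finType) (h : I -> 'I_d -> nat)
    (s : 'I_d -> nat) : cmeasurable (@trigsum R d I h s).
Proof.
apply: cmeasurable_big => [|i]; first exact: cmeasurableD.
exact: (cmeasurable_expi (measurable_phase _ _)).
Qed.

Lemma cmeasurable_riesz_trigsum (d : nat) (I : finType) (h : I -> 'I_d -> nat)
    (s : 'I_d -> nat) (r : R) :
  cmeasurable (fun x : d.-tuple R => riesz (trigsum h s) (radial r x)).
Proof.
under eq_fun do rewrite riesz_trigsum.
apply: cmeasurable_big => [|i]; first exact: cmeasurableD.
apply: cmeasurable_big => [|j]; first exact: cmeasurableM.
apply: cmeasurableX; apply: cmeasurableM; first exact: cmeasurable_cst.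
exact: (cmeasurable_expi (measurable_tnth j)).
Qed.

Lemma measurable_cabs_powR (d : nat) (f : d.-tuple R -> R[i]) (p : R) :
  cmeasurable f -> measurable_fun setT (fun x => (cabs (f x) `^ p)%:E).
Proof.
move=> [mr mi]; apply/measurable_EFinP.
apply: (measurableT_comp (measurable_powR p)).
apply: (measurableT_comp (continuous_measurable_fun (@sqrt_continuous R))).
by apply: measurable_funD; apply: measurable_funX.
Qed.

(** * Product formula and norm bound for the test functions *)

Variable k : nat.
Local Notation M := #|{: k.-tuple bool}|.

(** This is c_j(y): it involves only the first [M] coordinates, so for fixed y it is a translation
    of the variable x_j. *)
Definition offset (x : (M + k).-tuple R) (j : 'I_k) : R :=
  \sum_(c < M) ((true != tnth (enum_val c) j)%:R - (false != tnth (enum_val c) j)%:R)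
               * tnth x (lshift k c).

(** The unimodular character of exponent [s] undoes the shift; the distributive law then turns the
    sum over the cube into a product over letters. *)
Lemma cabs_trigsum_freq (s : 'I_(M + k) -> nat) (x : (M + k).-tuple R) :
  cabs (trigsum (@freq k) s x) =
  \prod_j cabs (cube_factor (fun i => expi (tnth x i)) j false
                + cube_factor (fun i => expi (tnth x i)) j true).
Proof.
rewrite -cabs_prod -sum_prod_tuple -[LHS]mulr1 -(cabs_expi (phase s (fun=> 0%N) x)) -cabsM.
congr cabs; rewrite mulr_suml; apply: eq_bigr => a _.
rewrite -prod_freq -expiD /phase -big_split expi_sum; apply: eq_bigr => i _ /=.
by rewrite -expi_natl; congr expi; ring.
Qed.

Lemma sqr_cabs_factorD (x : (M + k).-tuple R) (j : 'I_k) :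
  cabs (cube_factor (fun i => expi (tnth x i)) j false
        + cube_factor (fun i => expi (tnth x i)) j true) ^+ 2
  = 2 * (1 + cos (2 * pi * (tnth x (rshift M j) + offset x j))).
Proof.
have E b : cube_factor (fun i => expi (tnth x i)) j b =
   expi (\sum_(c < M) (b != tnth (enum_val c) j)%:R * tnth x (lshift k c)
         + b%:R * tnth x (rshift M j)).
  rewrite expiD expi_sum expi_natl; congr (_ * _); apply: eq_bigr => c _.
  by rewrite expi_natl.
rewrite addrC !E sqr_cabs_expiD; congr (2 * (1 + cos (2 * pi * _))).
rewrite mul1r mul0r addr0 addrAC addrC; congr (_ + _); rewrite -sumrB.
by apply: eq_bigr => c _; rewrite mulrBl.
Qed.

Lemma measurable_offset (j : 'I_k) : measurable_fun setT (fun x => offset x j).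
Proof.
by apply: measurable_sum => c; apply: measurable_funM => //; exact: measurable_tnth.
Qed.

Lemma measurable_majorant (q : R) : measurable_fun setT (majorant q).
Proof.
have mc : measurable_fun setT (fun t : R => cos (2 * pi * t)).
  apply: (@measurableT_comp _ _ _ _ _ _ (@cos R)).
    exact: (continuous_measurable_fun (@continuous_cos R)).
  exact: measurable_funM.
apply: measurable_funM => //; apply: measurable_funB.
  by apply: measurable_funD => //; apply: measurable_funM.
by apply: measurable_funM => //; apply: measurable_funX.
Qed.

Lemma haar_int_trigsum_le (q : R) (s : 'I_(M + k) -> nat) : 1 <= q < 2 ->
  (haar_int (fun x => (cabs (trigsum (@freq k) s x) `^ q)%:E)
   <= ((Num.sqrt 2 `^ q * (1 - (2 - q) / 32)) ^+ k)%:E)%E.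
Proof.
move=> q12.
pose G (x : (M + k).-tuple R) := \prod_j majorant q (tnth x (rshift M j) + offset x j).
have <- : haar_int (fun x => (G x)%:E) =
    ((Num.sqrt 2 `^ q * (1 - (2 - q) / 32)) ^+ k)%:E.
  apply: haar_int_cat => y.
  (* Padding y with zeros is harmless, as [offset] does not see the last [k] coordinates. *)
  pose c (j : 'I_k) := offset (cat_tuple y [tuple of nseq k (0 : R)]) j.
  rewrite -[X in X%:E]mul1r -(haar_int_prod_shift c _ (integral_majorant q)).
  apply: eq_haar_int => x; rewrite mul1r; congr EFin; apply: eq_bigr => j _.
  rewrite tnth_rshift; congr (majorant q (_ + _)).
  by apply: eq_bigr => i _; rewrite !tnth_lshift.
apply: haar_int_le.
- by apply: measurable_cabs_powR; exact: cmeasurable_trigsum.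
- apply/measurable_EFinP; apply: measurable_prod => j _.
  apply: (measurableT_comp (measurable_majorant q)).
  by apply: measurable_funD; [exact: measurable_tnth|exact: measurable_offset].
- by move=> x; rewrite lee_fin powR_ge0.
- move=> x; rewrite lee_fin cabs_trigsum_freq.
  rewrite powR_prod => [|j]; last exact: cabs_ge0.
  apply: ler_prod => j _; rewrite powR_ge0 /=.
  by apply: powR_le_majorant => //; [exact: cabs_ge0|exact: sqr_cabs_factorD].
Qed.

End UpperBound.

(** * Failure of contractivity and the limit *)

Section Contradiction.
Context {R : realType} (k : nat).
Local Notation M := #|{: k.-tuple bool}|.

Definition test_fun (qc : bool * bool) : (M + k).-tuple R -> R[i] :=
  trigsum (@freq k) (freq_shift (rs_set k qc)).

Lemma inLq_test_fun (q : R) (qc : bool * bool) : 1 <= q < 2 -> inLq q (test_fun qc).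
Proof.
move=> q12; have [mr mi] := @cmeasurable_trigsum R _ _ (@freq k) (freq_shift (rs_set k qc)).
split; [exact: measurable_funTS..|].
by apply: le_lt_trans (haar_int_trigsum_le _ q12) _; exact: ltry.
Qed.

(** The number eta of the overview is (1 - (2 - q) / 32)^(1 / q). *)
Lemma Lqnorm_test_fun (q : R) (qc : bool * bool) : 1 <= q < 2 ->
  Lqnorm q (test_fun qc) <= Num.sqrt 2 ^+ k * ((1 - (2 - q) / 32) ^+ k) `^ q^-1.
Proof.
move=> q12; have /andP[q1 q2] := q12.
have q0 : 0 < q by lra.
have d0 : 0 <= 1 - (2 - q) / 32 by lra.
have -> : Num.sqrt 2 ^+ k * ((1 - (2 - q) / 32) ^+ k) `^ q^-1 =
    ((Num.sqrt 2 `^ q * (1 - (2 - q) / 32)) ^+ k) `^ q^-1.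
  rewrite exprMn powRM ?exprn_ge0 ?powR_ge0 //; congr (_ * _).
  rewrite -!powR_mulrn ?powR_ge0 ?sqrtr_ge0 // -!powRrM; congr (_ `^ _).
  by field; rewrite gt_eqF.
have H := haar_int_trigsum_le (freq_shift (rs_set k qc)) q12.
have H0 : (0 <= haar_int (fun x => (cabs (test_fun qc x) `^ q)%:E))%E.
  by apply: haar_int_ge0 => x; rewrite lee_fin powR_ge0.
apply: ge0_ler_powR; rewrite ?invr_ge0 ?(ltW q0) ?nnegrE ?fine_ge0 //.
  by rewrite exprn_ge0 // mulr_ge0 ?powR_ge0.
by rewrite -lee_fin fineK // ge0_fin_numE // (le_lt_trans H) // ltry.
Qed.

(** The four squares add up to at least 2^k (r^(M + 1))^(2 k) >= 2^k / 4 = 4 C^2 with C = 2^(k/2) /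
    4, so one modulus is at least C. Compared with the torus, a factor 2 is given up to allow r < 1.
    Summing the p-th powers avoids choosing that index measurably. *)
Lemma riesz_test_fun_lower (r p : R) (x : (M + k).-tuple R) :
  0 <= r <= 1 -> 0 <= p -> 2^-1 <= (r ^+ M.+1) ^+ k ->
  (Num.sqrt 2 ^+ k / 4) `^ p
  <= \sum_qc cabs (riesz (test_fun qc) (radial r x)) `^ p.
Proof.
move=> r01 p0 rk; have /andP[r0 r1] := r01.
set C := _ / 4; set v := fun qc => cabs (riesz (test_fun qc) (radial r x)).
have C0 : 0 <= C by rewrite divr_ge0 ?exprn_ge0 ?sqrtr_ge0.
have zr i : cabs (radial r x i) = r by rewrite cabsM cabs_expi mulr1 cabs_real.
have rho0 : 0 <= r ^+ M.+1 by exact: exprn_ge0.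
have hw j b : r ^+ M.+1 <= cabs (cube_factor (radial r x) j b) by exact: cube_factor_lower.
have lower : 4 * C ^+ 2 <= \sum_qc v qc ^+ 2.
  apply: (@le_trans _ _ ((2 * (r ^+ M.+1) ^+ 2) ^+ k)); last first.
    apply: le_trans (rs_set_lower rho0 hw) _; apply: ler_sum => qc _.
    rewrite lerXn2r ?nnegrE ?cabs_ge0 // cabs_riesz_lower // => i.
    by rewrite zr.
  rewrite /C expr_div_n (exprAC (Num.sqrt 2)) sqr_sqrtr // exprMn [_ ^+ 2 ^+ k]exprAC.
  set a := _ ^+ k in rk *; set b := 2 ^+ k.
  have b0 : 0 <= b by exact: exprn_ge0.
  have a2 : b * 2^-1 ^+ 2 <= b * a ^+ 2.
    by rewrite ler_wpM2l // lerXn2r // nnegrE ?invr_ge0 ?(le_trans _ rk) ?invr_ge0.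
  by apply: le_trans a2; rewrite le_eqVlt; apply/predU1P; left; field.
have [qc Cv] : exists qc, C <= v qc.
  apply/not_existsP => vC; move: lower; apply/negP; rewrite -ltNge.
  have vC2 qc : v qc ^+ 2 < C ^+ 2.
    by rewrite ltrXn2r // ?nnegrE ?cabs_ge0 // ltNge; apply/negP.
  apply: (@lt_le_trans _ _ (\sum_(qc : bool * bool) C ^+ 2)).
    by apply: ltr_sum => //; apply/hasP; exists (true, true); rewrite // mem_index_enum.
  by rewrite sumr_const card_prod card_bool mulr_natl; exact: lexx.
rewrite (bigD1 qc) //= -[leLHS]addr0 lerD ?sumr_ge0 // => [|i _]; last exact: powR_ge0.
by rewrite ge0_ler_powR // nnegrE cabs_ge0.
Qed.

Lemma haar_int_riesz_le (q p r U : R) (qc : bool * bool) :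
  1 <= q < 2 -> 0 < p -> 0 <= r < 1 -> Lqnorm q (test_fun qc) <= U ->
  riesz_contractive (M + k) q p ->
  (haar_int (fun x => (cabs (riesz (test_fun qc) (radial r x)) `^ p)%:E)
   <= (U `^ p)%:E)%E.
Proof.
move=> q12 p0 r01 LU /(_ _ (inLq_test_fun qc q12)); rewrite gt_eqF // => HL.
have U0 : 0 <= U by apply: le_trans LU; exact: powR_ge0.
set H := haar_int _.
have H0 : (0 <= H)%E by apply: haar_int_ge0 => x; rewrite lee_fin powR_ge0.
have : (poweR H p^-1 <= U%:E)%E.
  apply: (@le_trans _ _ (Lqnorm q (test_fun qc))%:E); last by rewrite lee_fin.
  apply: le_trans HL; apply: ereal_sup_ubound; exists r => //=.
case: H H0 => [h|//|//]; last by rewrite poweRyr ?invr_eq0 ?gt_eqF.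
rewrite lee_fin poweR_EFin !lee_fin => h0 hU.
have -> : h = (h `^ p^-1) `^ p by rewrite -powRrM mulVf ?gt_eqF // powRr1.
by rewrite ge0_ler_powR ?nnegrE ?powR_ge0 // ltW.
Qed.

(** Integrating the pointwise bound C^p, each of the four projections contributes at most (2^(k/2)
    e)^p = (C 4 e)^p by contractivity; dividing by C^p removes the growth in [k]. *)
Lemma riesz_contractive_bound (q p : R) : 1 <= q < 2 -> 0 < p ->
  riesz_contractive (M + k) q p ->
  1 <= 4 * (4 * ((1 - (2 - q) / 32) ^+ k) `^ q^-1) `^ p.
Proof.
move=> q12 p0 contr; set e := _ `^ q^-1.
have e0 : 0 <= e by exact: powR_ge0.
(* The radius solves r^((M + 1) k + 1) = 1/2. The extra 1 keeps the exponent nonzero when [k] is 0,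
   so that r < 1. *)
pose a : R := (M.+1 * k).+1%:R^-1; pose r : R := 2^-1 `^ a.
have half : 0 < (2^-1 : R) < 1 by apply/andP; split; lra.
have r01 : 0 <= r < 1.
  rewrite powR_ge0 /=.
  have a0 : 0 < a by rewrite invr_gt0.
  have one : (1 : R) `^ a = 1 by rewrite powR1.
  rewrite -[ltRHS]one; apply: gt0_ltr_powR => //; rewrite ?nnegrE; lra.
have rk : 2^-1 <= (r ^+ M.+1) ^+ k.
  rewrite -exprM; apply: (@le_trans _ _ (r ^+ (M.+1 * k).+1)).
    by rewrite -powR_mulrn ?powR_ge0 // -powRrM mulVf // powRr1.
  by rewrite exprSr ler_piMr ?exprn_ge0; case/andP: r01 => // *; exact: ltW.
have r01' : 0 <= r <= 1 by case/andP: r01 => -> /ltW.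
pose C : R := Num.sqrt 2 ^+ k / 4.
have C0 : 0 < C by rewrite divr_gt0 // exprn_gt0 // sqrtr_gt0.
have UE : Num.sqrt 2 ^+ k * e = C * (4 * e) by rewrite /C; field.
pose g (qc : bool * bool) (x : (M + k).-tuple R) :=
  (cabs (riesz (test_fun qc) (radial r x)) `^ p)%:E.
have mg qc : measurable_fun setT (g qc).
  by apply: measurable_cabs_powR; exact: cmeasurable_riesz_trigsum.
have : ((C `^ p)%:E <= \sum_(qc : bool * bool) (((C * (4 * e)) `^ p)%:E))%E.
  apply: (@le_trans _ _ (haar_int (fun x => \sum_qc g qc x))%E).
    rewrite -[leLHS](haar_int_cst (M + k)); apply: haar_int_le => //.
    - exact: emeasurable_sum.
    - by move=> _; rewrite lee_fin powR_ge0.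
    - by move=> x; rewrite sumEFin lee_fin riesz_test_fun_lower // ltW.
  rewrite haar_int_sum => // [|qc x]; last by rewrite lee_fin powR_ge0.
  apply: lee_sum => qc _; apply: haar_int_riesz_le contr => //.
  by rewrite -UE Lqnorm_test_fun.
rewrite sumEFin lee_fin sumr_const card_prod card_bool powRM ?(ltW C0) ?mulr_ge0 //.
rewrite -[leLHS]mulr1 -mulrnAr ler_pM2l ?powR_gt0 // => /le_trans; apply.
by rewrite -mulr_natl.
Qed.

End Contradiction.

Section Limit.
Context {R : realType}.

(** If contractivity held for some p > p0, the smallness assumption would give (4 e)^p <= 8^(-p /
    p0) <= 1/8, and [riesz_contractive_bound] would yield 1 <= 4/8. As p > p0 > 0, the geometric
    mean case p = 0 does not occur. *)
Lemma pfrak_le (k : nat) (q p0 : R) : 1 <= q < 2 -> 0 < p0 ->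
  4 * ((1 - (2 - q) / 32) ^+ k) `^ q^-1 <= 8^-1 `^ p0^-1 ->
  (pfrak (#|{: k.-tuple bool}| + k) q <= p0%:E)%E.
Proof.
move=> q12 p00 small; rewrite /pfrak; case: ifP => _; last first.
  by rewrite lee_fin; lra.
apply: ge_ereal_sup => _ [p [p_ge0 contr] <-]; rewrite lee_fin leNgt; apply/negP => pp0.
have p_gt0 : 0 < p by exact: lt_trans pp0.
have := riesz_contractive_bound q12 p_gt0 contr.
set e := 4 * _ in small *.
have : e `^ p <= 8^-1.
  apply: (@le_trans _ _ ((8^-1 `^ p0^-1) `^ p)).
    by rewrite ge0_ler_powR ?nnegrE ?powR_ge0 ?mulr_ge0 ?powR_ge0 // ltW.
  rewrite -powRrM -[leRHS]powRr1; last by lra.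
  apply: ger_powR; first by apply/andP; split; lra.
  by rewrite mulrC ler_pdivlMr // mul1r ltW.
lra.
Qed.

Lemma pfrak_frequently_le (q p0 : R) : 1 <= q < 2 -> 0 < p0 ->
  forall N, exists2 d, (N <= d)%N & (pfrak d q <= p0%:E)%E.
Proof.
move=> q12 p00 N; have /andP[q1 q2] := q12.
pose d : R := 1 - (2 - q) / 32.
have d01 : `|d| < 1 by rewrite ltr_norml /d; apply/andP; split; lra.
(* Chosen so that d^k <= eps becomes exactly the smallness assumption of [pfrak_le]; here [d] is the
   decay ratio, not a dimension. *)
pose eps := (8^-1 `^ p0^-1 / 4) `^ q.
have eps0 : 0 < eps by rewrite powR_gt0 // divr_gt0 // powR_gt0 //; lra.
have [K _ HK] := cvgr_lt 0 (cvg_expr d01) eps eps0.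
pose k := maxn N K.
exists (#|{: k.-tuple bool}| + k)%N.
  by apply: leq_trans (leq_addl _ _); exact: leq_maxl.
apply: pfrak_le => //.
have dk : d ^+ k <= eps by apply/ltW/HK; exact: leq_maxr.
have d0 : 0 <= d ^+ k by rewrite exprn_ge0 // /d; lra.
have q0 : 0 < q by lra.
rewrite -ler_pdivlMl // [leRHS]mulrC.
apply: (@le_trans _ _ (eps `^ q^-1)).
  by rewrite ge0_ler_powR ?invr_ge0 ?nnegrE ?(ltW q0) ?(ltW eps0).
by rewrite /eps -powRrM divff ?gt_eqF // powRr1 // divr_ge0 ?powR_ge0.
Qed.

End Limit.

Theorem theorem12 (R : realType) (q : R) :
  1 <= q < 2 -> (limn (fun d : nat => pfrak d q) <= 0)%E.
Proof.
move=> q12; rewrite leNgt; apply/negP => lim_gt0.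
(* The default value of [limn] on a divergent sequence is 0, so a positive value forces
   convergence. *)
have cv : cvgn (fun d => pfrak d q).
  by apply: cvgNpoint; rewrite gt_eqF.
have [p0 p00 p0l] : exists2 p0 : R, 0 < p0 & (p0%:E < limn (fun d : nat => pfrak d q))%E.
  move: lim_gt0; case: (limn _) => [l|_|//]; last by exists 1; rewrite ?ltry.
  by rewrite lte_fin => l0; exists (l / 2); rewrite ?lte_fin; lra.
(* Convergence puts [pfrak d q] above p0 for all large d, so a single large dimension of the form
   2^k + k gives the contradiction. *)
have [N _ HN] : \forall d \near \oo, (p0%:E < pfrak d q)%E.
  exact: (cv _ (open_ereal_gt' p0l)).
have [d Nd] := pfrak_frequently_le q12 p00 N.
by rewrite leNgt HN.
Qed.
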